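(* Let $\mathrm{Sol}$ denote the set of stable polynomials $f=(f_n)_{n\ge 0}\in\mathbb{C}[X]$ such that for every $n\ge 2$ and every $1\le i<n$, \[ f_n(x_1,\dots,x_n)\big|_{x_{i+1}=x_i}=f_{n-2}(x_1,\dots,x_{i-1},x_{i+2},\dots,x_n) \] as polynomials (in particular the left-hand side does not depend on $x_i$). Then, as an algebra, $\mathrm{Sol}$ is isomorphic to the algebra $\mathit{QSym}$ of quasi-symmetric functions.
   Context: $X=\{x_1,x_2,\dots\}$. A stable polynomial is a sequence $f=(f_n)_{n\ge0}$ with $f_n\in\mathbb{C}[x_1,\dots,x_n]$, of bounded total degree, such that $f_{n+1}(x_1,\dots,x_n,0)=f_n(x_1,\dots,x_n)$ for all $n$; their set, with componentwise operations, is the algebra $\mathbb{C}[X]$. A composition is a finite sequence $I=(i_1,\dots,i_r)$ of positive integers. The monomial quasi-symmetric function $M_I$ is the stable polynomial $\sum_{a_1<\dots<a_r}x_{a_1}^{i_1}\cdots x_{a_r}^{i_r}$ (with $M_{()}=1$), and $\mathit{QSym}$ is the subalgebra of $\mathbb{C}[X]$ spanned by all $M_I$. *)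

(* Defs.v *)
From HB Require Import structures.
From mathcomp Require Import all_boot all_order all_algebra.
From mathcomp Require Import boolp.
From mathcomp Require Import mpoly.
From mathcomp Require Import ring.

Set Implicit Arguments.
Unset Strict Implicit.
Unset Printing Implicit Defensive.

Import GRing.Theory.
Local Open Scope ring_scope.

(* Variables are 0-based throughout: x_1, ..., x_n are 'X_0, ..., 'X_(n-1).   *)
(* Everything is defined over a commutative ring K; the case of interest is   *)
(* K = R[i] with R : realType.                                                *)

Section StablePolynomials.
Variable K : comNzRingType.

(* p(x_1, ..., x_n, 0) *)
Definition last_var0 n (p : {mpoly K[n.+1]}) : {mpoly K[n]} :=
  p \mPo [tuple (if unlift ord_max i is Some j then 'X_j else 0) | i < n.+1].

(* msize is the total degree plus 1 (and 0 for the zero polynomial). *)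
Record stable_poly := StablePoly {
  stable_val :> forall n, {mpoly K[n]};
  stable_bounded : exists d, forall n, (msize (stable_val n) <= d)%N;
  stable_last0 : forall n, last_var0 (stable_val n.+1) = stable_val n
}.

Lemma stable_polyP (f g : stable_poly) : (forall n, f n = g n) -> f = g.
Proof.
case: f g => [f bf sf] [g bg sg] /= fg.
have {}fg : f = g by apply: functional_extensionality_dep.
by case: _ / fg in bg sg *; rewrite (Prop_irrelevance bf bg)
  (Prop_irrelevance sf sg).
Qed.

HB.instance Definition _ := gen_eqMixin stable_poly.
HB.instance Definition _ := gen_choiceMixin stable_poly.

Lemma last_var0C n c : last_var0 (c%:MP : {mpoly K[n.+1]}) = c%:MP.
Proof. exact: comp_mpolyC. Qed.
Lemma last_var0N n (p : {mpoly K[n.+1]}) : last_var0 (- p) = - last_var0 p.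
Proof. exact: comp_mpolyN. Qed.
Lemma last_var0D n (p q : {mpoly K[n.+1]}) :
  last_var0 (p + q) = last_var0 p + last_var0 q.
Proof. exact: comp_mpolyD. Qed.
Lemma last_var0M n (p q : {mpoly K[n.+1]}) :
  last_var0 (p * q) = last_var0 p * last_var0 q.
Proof. exact: rmorphM. Qed.
Lemma last_var0Z n c (p : {mpoly K[n.+1]}) :
  last_var0 (c *: p) = c *: last_var0 p.
Proof. exact: comp_mpolyZ. Qed.

Lemma stableC_bounded (c : K) :
  exists d, forall n, (msize (c%:MP : {mpoly K[n]}) <= d)%N.
Proof. by exists 1%N => n; rewrite mmeasureC leq_b1. Qed.
Definition stableC c : stable_poly :=
  StablePoly (stableC_bounded c) (fun n => last_var0C n c).

Lemma stableN_bounded (f : stable_poly) :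
  exists d, forall n, (msize (- f n) <= d)%N.
Proof.
by case: (stable_bounded f) => d fd; exists d => n; rewrite mmeasureN.
Qed.
Lemma stableN_last0 (f : stable_poly) n : last_var0 (- f n.+1) = - f n.
Proof. by rewrite last_var0N stable_last0. Qed.
Definition stableN f : stable_poly :=
  StablePoly (stableN_bounded f) (stableN_last0 f).

Lemma stableD_bounded (f g : stable_poly) :
  exists d, forall n, (msize (f n + g n) <= d)%N.
Proof.
have [[d fd] [e ge]] := (stable_bounded f, stable_bounded g).
exists (maxn d e) => n; apply: leq_trans (mmeasureD_le _ _ _) _.
by rewrite geq_max !leq_max fd ge orbT.
Qed.
Lemma stableD_last0 (f g : stable_poly) n :
  last_var0 (f n.+1 + g n.+1) = f n + g n.
Proof. by rewrite last_var0D !stable_last0. Qed.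
Definition stableD f g : stable_poly :=
  StablePoly (stableD_bounded f g) (stableD_last0 f g).

Lemma stableM_bounded (f g : stable_poly) :
  exists d, forall n, (msize (f n * g n) <= d)%N.
Proof.
have [[d fd] [e ge]] := (stable_bounded f, stable_bounded g).
exists (d + e).+1 => n; apply: leq_trans (msizeM_le _ _) _.
by rewrite ltnS leq_add.
Qed.
Lemma stableM_last0 (f g : stable_poly) n :
  last_var0 (f n.+1 * g n.+1) = f n * g n.
Proof. by rewrite last_var0M !stable_last0. Qed.
Definition stableM f g : stable_poly :=
  StablePoly (stableM_bounded f g) (stableM_last0 f g).

Lemma stableZ_bounded c (f : stable_poly) :
  exists d, forall n, (msize (c *: f n) <= d)%N.
Proof.
have [d fd] := stable_bounded f.
by exists d => n; apply: leq_trans (msizeZ_le _ _) (fd n).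
Qed.
Lemma stableZ_last0 c (f : stable_poly) n : last_var0 (c *: f n.+1) = c *: f n.
Proof. by rewrite last_var0Z !stable_last0. Qed.
Definition stableZ c f : stable_poly :=
  StablePoly (stableZ_bounded c f) (stableZ_last0 c f).

Fact stable_addA : associative stableD.
Proof. by move=> f g h; apply: stable_polyP => n /=; rewrite addrA. Qed.
Fact stable_addC : commutative stableD.
Proof. by move=> f g; apply: stable_polyP => n /=; rewrite addrC. Qed.
Fact stable_add0 : left_id (stableC 0) stableD.
Proof. by move=> f; apply: stable_polyP => n /=; rewrite mpolyC0 add0r. Qed.
Fact stable_addN : left_inverse (stableC 0) stableN stableD.
Proof. by move=> f; apply: stable_polyP => n /=; rewrite mpolyC0 addNr. Qed.
HB.instance Definition _ := GRing.isZmodule.Build stable_poly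
  stable_addA stable_addC stable_add0 stable_addN.

Fact stable_mulA : associative stableM.
Proof. by move=> f g h; apply: stable_polyP => n /=; rewrite mulrA. Qed.
Fact stable_mulC : commutative stableM.
Proof. by move=> f g; apply: stable_polyP => n /=; rewrite mulrC. Qed.
Fact stable_mul1 : left_id (stableC 1) stableM.
Proof. by move=> f; apply: stable_polyP => n /=; rewrite mpolyC1 mul1r. Qed.
Fact stable_mulDl : left_distributive stableM +%R.
Proof. by move=> f g h; apply: stable_polyP => n /=; rewrite mulrDl. Qed.
Fact stable_1neq0 : stableC 1 != 0.
Proof.
apply/eqP => /(congr1 (fun f : stable_poly => f 0%N)) /= /eqP.
by rewrite mpolyC0 mpolyC_eq0 oner_eq0.
Qed.
HB.instance Definition _ := GRing.Zmodule_isComNzRing.Build stable_poly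
  stable_mulA stable_mulC stable_mul1 stable_mulDl stable_1neq0.

Fact stable_scaleA a b f : stableZ a (stableZ b f) = stableZ (a * b) f.
Proof. by apply: stable_polyP => n /=; rewrite scalerA. Qed.
Fact stable_scale1 : left_id 1 stableZ.
Proof. by move=> f; apply: stable_polyP => n /=; rewrite scale1r. Qed.
Fact stable_scaleDr : right_distributive stableZ +%R.
Proof. by move=> a f g; apply: stable_polyP => n /=; rewrite scalerDr. Qed.
Fact stable_scaleDl f : {morph stableZ^~ f : a b / a + b}.
Proof. by move=> a b; apply: stable_polyP => n /=; rewrite scalerDl. Qed.
HB.instance Definition _ := GRing.Zmodule_isLmodule.Build K stable_poly
  stable_scaleA stable_scale1 stable_scaleDr stable_scaleDl.

Fact stable_scaleAl (a : K) (f g : stable_poly) : a *: (f * g) = a *: f * g.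
Proof. by apply: stable_polyP => n /=; rewrite scalerAl. Qed.
HB.instance Definition _ := GRing.Lmodule_isLalgebra.Build K stable_poly
  stable_scaleAl.
HB.instance Definition _ :=
  GRing.Lalgebra_isComAlgebra.Build K stable_poly.

Lemma stable_val0 n : (0 : stable_poly) n = 0. Proof. exact: mpolyC0. Qed.
Lemma stable_val1 n : (1 : stable_poly) n = 1. Proof. by []. Qed.
Lemma stable_valD (f g : stable_poly) n : (f + g) n = f n + g n.
Proof. by []. Qed.
Lemma stable_valM (f g : stable_poly) n : (f * g) n = f n * g n.
Proof. by []. Qed.
Lemma stable_valZ c (f : stable_poly) n : (c *: f) n = c *: f n.
Proof. by []. Qed.
Lemma stable_val_sum T (r : seq T) (F : T -> stable_poly) n :
  (\sum_(t <- r) F t) n = \sum_(t <- r) F t n.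
Proof.
by elim/big_rec2: _ => [|t p f _ <-]; rewrite ?stable_val0 ?stable_valD.
Qed.

End StablePolynomials.

Section Sol.
Variable K : comNzRingType.

(* p(x_1, ..., x_(m+2)) with the variable at (0-based) position i.+1          *)
(* replaced by the one at position i, for i <= m.                             *)
Definition merge_vars m (i : 'I_m.+1) (p : {mpoly K[m.+2]}) :
    {mpoly K[m.+2]} :=
  p \mPo [tuple 'X_(if j == i.+1 :> nat then inord i else j) | j < m.+2].

(* q(x_1, ..., x_m) evaluated at the m variables left after deleting the ones *)
(* at (0-based) positions i and i.+1 from a list of m.+2 variables.           *)
Definition skip_vars m (i : 'I_m.+1) (q : {mpoly K[m]}) : {mpoly K[m.+2]} :=
  q \mPo [tuple 'X_(inord (if (j < i)%N then j : nat else j.+2)) | j < m].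

Definition Sol_prop (f : stable_poly K) : Prop :=
  forall m (i : 'I_m.+1), merge_vars i (f m.+2) = skip_vars i (f m).

Definition Sol : {pred stable_poly K} := fun f => `[< Sol_prop f >].

Fact Sol_subalg_closed : GRing.subalg_closed Sol.
Proof.
split=> [|c f g /asboolP fS /asboolP gS|f g /asboolP fS /asboolP gS];
  apply/asboolP => m i.
- by rewrite !stable_val1 /merge_vars /skip_vars !comp_mpoly1.
- rewrite !stable_valD !stable_valZ /merge_vars /skip_vars.
  by rewrite !comp_mpolyD !comp_mpolyZ [X in c *: X]fS [X in _ + X]gS.
- rewrite !stable_valM /merge_vars /skip_vars !rmorphM /=.
  by congr (_ * _); [apply: fS | apply: gS].
Qed.
HB.instance Definition _ := GRing.isSubalgClosed.Build K (stable_poly K) Sol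
  Sol_subalg_closed.

Definition Sol_alg := {f | f \in Sol}.
HB.instance Definition _ := SubType.on Sol_alg.
HB.instance Definition _ := Choice.on Sol_alg.
HB.instance Definition _ := [SubChoice_isSubAlgebra of Sol_alg by <:].
HB.instance Definition _ :=
  [SubNzRing_isSubComNzRing of Sol_alg by <:].

End Sol.

Section QSym.
Variable K : comNzRingType.

Definition composition := {I : seq nat | all (fun i => 0 < i)%N I}.

(* M_I(x_1, ..., x_n), for any sequence I of exponents *)
Definition monomial_qsym n (I : seq nat) : {mpoly K[n]} :=
  \sum_(a : (size I).-tuple 'I_n | sorted ltn (map val a))
    \prod_(k < size I) 'X_(tnth a k) ^+ nth 0%N I k.

Lemma monomial_qsym_homog n I : monomial_qsym n I \is (sumn I).-homog.
Proof.
apply: rpred_sum => a _; rewrite sumnE (big_nth 0%N) big_mkord.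
elim/big_rec2: _ => [|k d p _ pd]; first exact: dhomog1.
apply: dhomogM => //; rewrite -[X in X.-homog]mul1n; apply: dhomogMn.
by rewrite dhomogX /= mdeg1.
Qed.

Lemma monomial_qsym_bounded I :
  exists d, forall n, (msize (monomial_qsym n I) <= d)%N.
Proof.
exists (sumn I).+1 => n; rewrite msizeE; apply/bigmax_leqP_seq => m mI _.
by rewrite ltnS (dhomog_mf (monomial_qsym_homog n I) mI).
Qed.

(* The increasing sequences of length r in {0, ..., n-1}; the recursion on n   *)
(* yields the rule monomial_qsym_rcons below, which splits off the last       *)
(* variable and gives both stability and the quasi-shuffle product.           *)
Fixpoint incr_seqs n r : seq (seq nat) :=
  if r isn't r'.+1 then [:: [::]] else
  if n isn't n'.+1 then [::] else
  incr_seqs n' r ++ [seq rcons a n' | a <- incr_seqs n' r'].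

Lemma sorted_ltn_rcons a n :
  sorted ltn (rcons a n) = all (ltn^~ n) a && sorted ltn a.
Proof. by rewrite !(sorted_pairwise ltn_trans) pairwise_rcons. Qed.

Lemma mem_incr_seqs n r a : (a \in incr_seqs n r) =
  [&& size a == r, sorted ltn a & all (ltn^~ n) a].
Proof.
elim: n r a => [|n IHn] [|r] a /=.
- by rewrite inE -size_eq0; case: a.
- by case: a => //= x s; rewrite !andbF.
- by rewrite inE -size_eq0; case: a.
rewrite mem_cat IHn; case/lastP: a => [|a x].
  by apply/mapP => -[b _ /(congr1 size)]; rewrite size_rcons.
rewrite size_rcons eqSS sorted_ltn_rcons !all_rcons.
have -> : (rcons a x \in [seq rcons b n | b <- incr_seqs n r]) =
    (x == n) && (a \in incr_seqs n r).
  apply/mapP/andP => [[b bP /rcons_inj [-> ->]] //|[/eqP -> aP]].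
  by exists a.
rewrite IHn; case: (size a == r); rewrite ?andbF /=; last by [].
rewrite ltnS; case: (ltngtP x n) => xn; rewrite /= ?andbF ?andbT ?orbF //=.
  case ax: (all (ltn^~ x) a) => //=; congr (_ && _).
  by rewrite !(sub_all _ ax) // => y /= yx; rewrite ?leqW // (ltn_trans yx).
case an: (all (ltn^~ x) a); rewrite xn in an; rewrite ?xn an ?andbF //= andbT.
by rewrite (sub_all _ an) ?andbT // => y /= /leqW.
Qed.

Lemma incr_seqs_uniq n r : uniq (incr_seqs n r).
Proof.
elim: n r => [|n IHn] [|r] //=; rewrite cat_uniq !IHn map_inj_uniq ?IHn.
  rewrite andbT; apply/hasPn => _ /mapP[a _ ->].
  by rewrite mem_incr_seqs all_rcons /= ltnn /= !andbF.
by move=> a b /rcons_inj [].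
Qed.

Definition var_nat n (j : nat) : {mpoly K[n]} :=
  oapp (fun i : 'I_n => 'X_i) 0 (insub j).

Lemma var_nat_ord n (i : 'I_n) : var_nat n i = 'X_i.
Proof. by rewrite /var_nat valK. Qed.

Definition monomial_seq n (I a : seq nat) : {mpoly K[n]} :=
  \prod_(k < size I) var_nat n (nth 0%N a k) ^+ nth 0%N I k.

Lemma monomial_qsymE n I : monomial_qsym n I =
  \sum_(a <- incr_seqs n (size I)) monomial_seq n I a.
Proof.
pose w (t : (size I).-tuple 'I_n) := map val t.
transitivity (\sum_(a <- [seq w t | t <- enum {: (size I).-tuple 'I_n}
    & sorted ltn (w t)]) monomial_seq n I a).
  rewrite big_map big_filter big_enum_cond; apply: eq_bigr => t _.
  apply: eq_bigr => k _; congr (_ ^+ _).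
  have kt : (k < size t)%N by rewrite size_tuple.
  by rewrite (nth_map (tnth t k)) // -tnth_nth var_nat_ord.
apply/perm_big/uniq_perm; last move=> a.
- rewrite map_inj_uniq ?filter_uniq -?enumT ?enum_uniq // => t u /inj_map tu.
  by apply/val_inj/tu/val_inj.
- exact: incr_seqs_uniq.
rewrite mem_incr_seqs; apply/mapP/and3P => [[t]|[/eqP sz sa an]].
  rewrite mem_filter => /andP[ts _] ->; split=> //.
    by rewrite size_map size_tuple.
  by apply/allP => _ /mapP[i _ ->] /=.
have [b Eb] : exists b : seq 'I_n, a = map val b.
  elim: a an {sz sa} => [|x a IHa] /=; first by exists [::].
  by move=> /andP[xn /IHa[b ->]]; exists (Ordinal xn :: b).
have szb : size b == size I by rewrite -sz Eb size_map.
exists (Tuple szb) => //.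
by rewrite mem_filter mem_enum /w /= -Eb sa.
Qed.

Lemma monomial_qsym_nil n : monomial_qsym n [::] = 1.
Proof.
rewrite monomial_qsymE; have -> : incr_seqs n 0 = [:: [::]] by case: n.
by rewrite big_seq1 /monomial_seq big_ord0.
Qed.

Lemma monomial_qsym0 I i : monomial_qsym 0 (rcons I i) = 0.
Proof. by rewrite monomial_qsymE size_rcons big_nil. Qed.

Lemma mwiden_var_nat n j : (j < n)%N ->
  mwiden (var_nat n j) = var_nat n.+1 j.
Proof.
move=> jn; rewrite -[j]/(val (Ordinal jn)) var_nat_ord mwidenX mnmwiden1.
exact/esym/(var_nat_ord (widen_ord (leqnSn n) (Ordinal jn))).
Qed.

Lemma var_nat_max n : var_nat n.+1 n = 'X_ord_max.
Proof. exact: (var_nat_ord (@ord_max n)). Qed.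

Lemma mwiden_monomial_seq n I a : size a = size I -> all (ltn^~ n) a ->
  mwiden (monomial_seq n I a) = monomial_seq n.+1 I a.
Proof.
move=> szI an; rewrite /monomial_seq rmorph_prod; apply: eq_bigr => k _ /=.
rewrite rmorphXn /= mwiden_var_nat //.
by apply: (all_nthP 0%N an); rewrite szI.
Qed.

Lemma monomial_qsym_rcons n I i : monomial_qsym n.+1 (rcons I i) =
  mwiden (monomial_qsym n (rcons I i)) +
  mwiden (monomial_qsym n I) * 'X_ord_max ^+ i.
Proof.
rewrite !monomial_qsymE size_rcons /= big_cat big_map /=; congr (_ + _).
  rewrite raddf_sum; apply: eq_big_seq => a.
  rewrite mem_incr_seqs => /and3P[/eqP sza _ an].
  by rewrite /= mwiden_monomial_seq // size_rcons.
rewrite raddf_sum mulr_suml; apply: eq_big_seq => a.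
rewrite mem_incr_seqs => /and3P[/eqP sza _ an] /=.
rewrite mwiden_monomial_seq // /monomial_seq size_rcons big_ord_recr /=.
congr (_ * _).
  by apply: eq_bigr => k _; rewrite !nth_rcons sza ltn_ord.
by rewrite !nth_rcons sza ltnn eqxx var_nat_max.
Qed.

Lemma mwidenK n (p : {mpoly K[n]}) : last_var0 (mwiden p) = p.
Proof.
rewrite [X in mwiden X]mpolyE raddf_sum /last_var0 raddf_sum /= [RHS]mpolyE.
apply: eq_bigr => m _; rewrite -mul_mpolyC mwidenM mwidenC mwidenX.
rewrite rmorphM /= comp_mpolyC comp_mpolyX; congr (_ * _).
rewrite big_ord_recr /= mnmwiden_ordmax expr0 mulr1 [RHS]mpolyXE_id.
apply: eq_bigr => i _; rewrite mnmwiden_widen tnth_mktuple; congr (_ ^+ _).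
have -> : widen_ord (leqnSn n) i = lift ord_max i.
  by apply: val_inj; rewrite /= /bump leqNgt ltn_ord.
by rewrite liftK.
Qed.

Lemma monomial_qsym_last0 (I : composition) n :
  last_var0 (monomial_qsym n.+1 (val I)) = monomial_qsym n (val I).
Proof.
case: I => I /=; case/lastP: I => [|I i].
  by rewrite !monomial_qsym_nil /last_var0 comp_mpoly1.
rewrite all_rcons => /andP[i_gt0 _].
rewrite monomial_qsym_rcons last_var0D last_var0M !mwidenK.
rewrite /last_var0 rmorphXn /= comp_mpolyXU -tnth_nth tnth_mktuple.
by rewrite unlift_none expr0n (gtn_eqF i_gt0) mulr0 addr0.
Qed.

Definition QSym_M (I : composition) : stable_poly K :=
  StablePoly (monomial_qsym_bounded (val I)) (monomial_qsym_last0 I).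

Definition QSym_prop (f : stable_poly K) : Prop :=
  exists s : seq (K * composition), f = \sum_(t <- s) t.1 *: QSym_M t.2.

Definition QSym : {pred stable_poly K} := fun f => `[< QSym_prop f >].

Lemma monomial_qsymM (I J : composition) : exists s : seq composition,
  forall n, monomial_qsym n (val I) * monomial_qsym n (val J) =
    \sum_(L <- s) monomial_qsym n (val L).
Proof.
suff [s sP sE] : exists2 s : seq (seq nat), all (all (fun i => 0 < i)%N) s &
    forall n, monomial_qsym n (val I) * monomial_qsym n (val J) =
      \sum_(L <- s) monomial_qsym n L.
  have [t Et] : exists t : seq composition, s = map val t.
    elim: s sP {sE} => [|L s IHs] /=; first by exists [::].
    by move=> /andP[LP /IHs[t ->]]; exists (exist _ L LP :: t).
  by exists t => n; rewrite sE Et big_map.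
case: I J => I IP [J JP] /=.
have [d] := ubnP (size I + size J); elim: d => // d IHd in I J IP JP *.
case/lastP: I IP => [|I i] IP.
  by exists [:: J]; rewrite /= ?JP // => n;
     rewrite monomial_qsym_nil mul1r big_seq1.
case/lastP: J JP => [|J j] JP.
  by exists [:: rcons I i]; rewrite /= ?IP // => n;
     rewrite monomial_qsym_nil mulr1 big_seq1.
rewrite !size_rcons addSn addnS !ltnS => szd.
move: (IP) (JP); rewrite !all_rcons => /andP[i0 IP'] /andP[j0 JP'].
have [|s1 s1P s1E] := IHd I (rcons J j) IP' JP.
  by rewrite size_rcons addnS.
have [|s2 s2P s2E] := IHd (rcons I i) J IP JP'; first by rewrite size_rcons.
have [|s3 s3P s3E] := IHd I J IP' JP'; first exact: leq_trans szd.
exists (map (rcons^~ i) s1 ++ map (rcons^~ j) s2 ++ map (rcons^~ (i + j)%N) s3).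
  have rP k (s : seq (seq nat)) : (0 < k)%N -> all (all (fun i => 0 < i)%N) s ->
      all (all (fun i => 0 < i)%N) (map (rcons^~ k) s).
    move=> k0 /allP sP; apply/allP => _ /mapP[L /sP LP ->].
    by rewrite all_rcons k0.
  by rewrite !all_cat !rP // addn_gt0 i0.
have recE n k (s : seq (seq nat)) :
    \sum_(L <- map (rcons^~ k) s) monomial_qsym n.+1 L =
    mwiden (\sum_(L <- map (rcons^~ k) s) monomial_qsym n L) +
    mwiden (\sum_(L <- s) monomial_qsym n L) * 'X_ord_max ^+ k.
  rewrite !big_map !raddf_sum mulr_suml -big_split; apply: eq_bigr => L _ /=.
  exact: monomial_qsym_rcons.
elim=> [|n IHn].
  rewrite monomial_qsym0 mul0r big1_seq // => L /andP[_].
  by rewrite !mem_cat => /or3P[] /mapP[L' _ ->]; rewrite monomial_qsym0.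
rewrite !big_cat /= !recE -s1E -s2E -s3E !monomial_qsym_rcons !mwidenM.
have := congr1 (@mwiden _ _) IHn; rewrite !big_cat /= !mwidenD mwidenM => E.
rewrite !mulrDl !mulrDr E exprD.
set A := mwiden _; set B := mwiden _; set C := mwiden _.
set D := mwiden _; set F := mwiden (monomial_qsym n I).
set G := mwiden (monomial_qsym n (rcons J j)).
set H := mwiden (monomial_qsym n J); set x := 'X_ord_max ^+ i.
set y := 'X_ord_max ^+ j.
ring.
Qed.

Fact QSym_subalg_closed : GRing.subalg_closed QSym.
Proof.
have lin : GRing.linear_closed QSym.
  move=> c f g /asboolP[s ->] /asboolP[t ->]; apply/asboolP.
  exists ([seq (c * u.1, u.2) | u <- s] ++ t); rewrite big_cat big_map.
  rewrite scaler_sumr; congr (_ + _); apply: eq_bigr => u _ /=.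
  by rewrite scalerA.
have q0 : 0 \in QSym by apply/asboolP; exists [::]; rewrite big_nil.
have qZD c f g : f \in QSym -> g \in QSym -> c *: f + g \in QSym.
  exact: lin.
split=> //.
  apply/asboolP; exists [:: (1, exist _ [::] isT)]; rewrite big_seq1 scale1r.
  by apply: stable_polyP => n /=; rewrite monomial_qsym_nil.
move=> f g /asboolP[s ->] /asboolP[t ->]; rewrite mulr_suml.
elim/big_rec: _ => // u f' _ f'Q; rewrite -scalerAl; apply: (qZD) => //.
rewrite mulr_sumr; elim/big_rec: _ => // v g' _ g'Q.
rewrite -scalerAr; apply: (qZD) => //; apply/asboolP.
have [r rE] := monomial_qsymM u.2 v.2.
exists [seq (1, L) | L <- r]; apply: stable_polyP => n.
rewrite stable_valM rE stable_val_sum big_map; apply: eq_bigr => L _.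
by rewrite stable_valZ scale1r.
Qed.
HB.instance Definition _ := GRing.isSubalgClosed.Build K (stable_poly K) QSym
  QSym_subalg_closed.

Definition QSym_alg := {f | f \in QSym}.
HB.instance Definition _ := SubType.on QSym_alg.
HB.instance Definition _ := Choice.on QSym_alg.
HB.instance Definition _ := [SubChoice_isSubAlgebra of QSym_alg by <:].
HB.instance Definition _ :=
  [SubNzRing_isSubComNzRing of QSym_alg by <:].

End QSym.

(* Main.v *)
(* Write f(w) for the value of a stable polynomial f on a finite word w of
   polynomials. An element f of Sol is unchanged when a factor a a is deleted
   from w, so the isomorphism is the restriction f -> f(x_1, 0, x_2, 0, ...) to
   the odd variables.
   - The image is quasi-symmetric: setting x_i = 0 produces 0 0 0, which
     collapses to 0, and invariance under deletion of zero variables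
     characterizes QSym.
   - Injectivity: on words, the block N_x = (0, x) is inverse to P_x = (x, 0),
     and (P_x - 1)^k kills polynomials of degree < k, since a monomial of
     degree < k misses one of the k positions involved. Hence
     N_x = sum_j (1 - P_x)^j is a finite sum, and every f(w) is a combination
     of values of f on products of blocks P_y.
   - Surjectivity: M_I is the image of M_I evaluated on the virtual alphabet
     x_1 - x_2 + x_3 - ..., where subtracting x means convolution with the
     character M_I -> (-1)^(length I) x^|I| inverse to evaluation at x. *)
Require Import Defs.
From HB Require Import structures.
From mathcomp Require Import all_boot all_order all_algebra.
From mathcomp Require Import boolp mpoly.
From mathcomp Require Import complex.
From mathcomp Require Import reals.

Set Implicit Arguments.
Unset Strict Implicit.
Unset Printing Implicit Defensive.

Import GRing.Theory.
Local Open Scope ring_scope.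
Local Open Scope complex_scope.

(** * Substitution of words of polynomials *)

Section Substitution.
Variable K : comNzRingType.

Lemma comp_mpoly_comp k l n (p : {mpoly K[n]}) (t : n.-tuple {mpoly K[k]})
    (u : k.-tuple {mpoly K[l]}) :
  (p \mPo t) \mPo u = p \mPo [tuple tnth t i \mPo u | i < n].
Proof.
rewrite [X in X \mPo u]comp_mpolyEX [RHS]comp_mpolyEX raddf_sum /=.
apply: eq_bigr => m _.
rewrite comp_mpolyZ !comp_mpolyX rmorph_prod /=; congr (_ *: _).
by apply: eq_bigr => i _; rewrite rmorphXn /= tnth_mktuple.
Qed.

(** Words are sequences, not tuples, so that letters can be inserted and deleted without casts.
    Missing letters default to 0, in accordance with stability. *)
Definition subst {N n} (p : {mpoly K[n]}) (s : seq {mpoly K[N]}) :=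
  p \mPo [tuple nth 0 s i | i < n].

Lemma comp_mpoly_subst N n (p : {mpoly K[n]}) (t : n.-tuple {mpoly K[N]}) :
  p \mPo t = subst p t.
Proof.
by congr (_ \mPo _); apply: eq_from_tnth => i; rewrite tnth_mktuple -tnth_nth.
Qed.

Lemma eq_subst N n (p : {mpoly K[n]}) (s t : seq {mpoly K[N]}) :
  (forall i, (i < n)%N -> nth 0 s i = nth 0 t i) -> subst p s = subst p t.
Proof.
by move=> st; congr (_ \mPo _); apply: eq_mktuple => i; apply: st.
Qed.

Lemma subst_comp k l n (p : {mpoly K[n]}) (s : seq {mpoly K[k]})
    (u : k.-tuple {mpoly K[l]}) :
  subst p s \mPo u = subst p [seq x \mPo u | x <- s].
Proof.
rewrite comp_mpoly_comp; congr (_ \mPo _); apply: eq_mktuple => i.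
rewrite tnth_mktuple; have [si|si] := ltnP i (size s).
  by rewrite (nth_map 0).
by rewrite !nth_default ?size_map // comp_mpoly0.
Qed.

Lemma substE N n (p : {mpoly K[n]}) (s : seq {mpoly K[N]}) :
  subst p s = \sum_(m <- msupp p) p@_m *: \prod_(i < n) nth 0 s i ^+ m i.
Proof.
rewrite /subst [LHS]comp_mpolyEX; apply: eq_bigr => m _.
by rewrite comp_mpolyX; congr (_ *: _); apply: eq_bigr => i _;
   rewrite tnth_mktuple.
Qed.

Lemma msize_subst_le N n (p : {mpoly K[n]}) (s : seq {mpoly K[N]}) :
  {in s, forall x, x \is 1.-homog} -> (msize (subst p s) <= msize p)%N.
Proof.
move=> sh; rewrite substE.
elim/big_ind: _ => [|a b la lb|m _]; first by rewrite mmeasure0.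
  by apply: leq_trans (mmeasureD_le _ _ _) _; rewrite geq_max la.
have [mp|] := boolP (m \in msupp p); last first.
  by rewrite -mcoeff_eq0 => /eqP ->; rewrite scale0r mmeasure0.
apply: leq_trans (msizeZ_le _ _) _; apply: leq_trans (msize_mdeg_lt mp).
suff /dhomog_mf h : \prod_(i < n) nth 0 s i ^+ m i \is (mdeg m).-homog.
  by rewrite msizeE; apply/bigmax_leqP_seq => m' /h /= <-.
rewrite mdegE; elim/big_rec2: _ => [|i d q _ qd]; first exact: dhomog1.
apply: dhomogM => //; rewrite -[X in X.-homog]mul1n; apply: dhomogMn.
have [si|si] := ltnP i (size s); first exact: sh (mem_nth _ si).
by rewrite nth_default // dhomog0.
Qed.

Definition vars n : seq {mpoly K[n]} := [seq 'X_i | i <- enum 'I_n].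

Lemma size_vars n : size (vars n) = n.
Proof. by rewrite size_map size_enum_ord. Qed.

Lemma nth_vars n (i : 'I_n) : nth 0 (vars n) i = 'X_i.
Proof. by rewrite (nth_map i) ?size_enum_ord // nth_ord_enum. Qed.

Lemma subst_vars n (p : {mpoly K[n]}) : subst p (vars n) = p.
Proof.
rewrite -[RHS]comp_mpoly_id; congr (_ \mPo _); apply: eq_mktuple => i.
exact: nth_vars.
Qed.

Lemma varsS n : vars n.+1 = rcons [seq mwiden x | x <- vars n] 'X_ord_max.
Proof.
apply: (@eq_from_nth _ 0) => [|i].
  by rewrite size_vars size_rcons size_map size_vars.
rewrite size_vars => lin.
rewrite -[X in nth _ _ X = _]/(val (Ordinal lin)) nth_vars.
rewrite nth_rcons size_map size_vars; have [ni|ni|ni] := ltngtP.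
- rewrite (nth_map 0) ?size_vars //.
  rewrite -[X in nth _ _ X]/(val (Ordinal ni)) nth_vars mwidenX mnmwiden1.
  by congr 'X_[U_(_)%MM]; apply: val_inj.
- by have := leq_ltn_trans ni lin; rewrite ltnn.
- by congr 'X_[U_(_)%MM]; apply: val_inj.
Qed.

End Substitution.

(** * Values on words; [Sol] as invariance under deletion of a repeated letter *)

Section Evaluation.
Variable K : comNzRingType.
Implicit Type f : stable_poly K.

Definition ev f {N} (s : seq {mpoly K[N]}) := subst (f (size s)) s.

(** Setting the last variable of [f n.+1] to 0 gives [f n], so every component with enough variables
    yields the same value on s padded by zeros. *)
Lemma subst_stable f N n (s : seq {mpoly K[N]}) :
  (size s <= n)%N -> subst (f n) s = ev f s.
Proof.
elim: n => [|n IHn].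
  by rewrite leqn0 /ev => /eqP ->.
rewrite leq_eqVlt => /orP[/eqP <- //|]; rewrite ltnS => sn.
rewrite -IHn // -(stable_last0 f n) /last_var0 [RHS]comp_mpoly_comp.
congr (_ \mPo _); apply: eq_mktuple => i; rewrite tnth_mktuple.
case: unliftP => [j ->|->]; last first.
  by rewrite comp_mpoly0 nth_default.
by rewrite comp_mpolyXU -tnth_nth tnth_mktuple /= /bump leqNgt ltn_ord.
Qed.

Lemma ev_vars f n : ev f (vars K n) = f n.
Proof. by rewrite /ev size_vars subst_vars. Qed.

Lemma ev_comp f k l (s : seq {mpoly K[k]}) (u : k.-tuple {mpoly K[l]}) :
  ev f s \mPo u = ev f [seq x \mPo u | x <- s].
Proof. by rewrite /ev subst_comp size_map. Qed.

Lemma ev_rcons0 f N (s : seq {mpoly K[N]}) : ev f (rcons s 0) = ev f s.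
Proof.
rewrite -(@subst_stable f N (size s).+1 s) // /ev size_rcons.
apply: eq_subst => i; rewrite ltnS nth_rcons; case: ltngtP => // -> _.
by rewrite nth_default.
Qed.

(** Substitute the whole word into the defining identity of [Sol] at position [size u]: merging is
    invisible, as both letters there are already a. *)
Lemma Sol_ev f N (u v : seq {mpoly K[N]}) a :
  Sol_prop f -> ev f (u ++ a :: a :: v) = ev f (u ++ v).
Proof.
move=> fS; set s := u ++ a :: a :: v.
have szs : size s = (size u + size v).+2 by rewrite size_cat /= !addnS.
have iP : (size u < (size u + size v).+1)%N by rewrite ltnS leq_addr.
pose i := Ordinal iP.
have := congr1 (fun p : {mpoly K[_]} =>
  p \mPo [tuple nth 0 s j | j < (size u + size v).+2]) (fS _ i).
rewrite /merge_vars /skip_vars !comp_mpoly_comp /ev szs size_cat => E.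
transitivity (f (size u + size v).+2 \mPo [tuple tnth [tuple 'X_(if
    j == i.+1 :> nat then inord i else j) | j < (size u + size v).+2] j0
    \mPo [tuple nth 0 s j | j < (size u + size v).+2]
    | j0 < (size u + size v).+2]); last rewrite E; congr (_ \mPo _);
  apply: eq_mktuple => j; rewrite !tnth_mktuple comp_mpolyXU -tnth_nth
    tnth_mktuple.
  case: eqP => //= ->; rewrite inordK; last by rewrite ltnS ltnW.
  by rewrite /s !nth_cat ltnn ltnNge leqnSn subnn subSnn.
have jn : (j < (size u + size v).+1)%N by rewrite ltnS ltnW.
rewrite inordK; last by case: (j < i)%N; rewrite ?ltnS // ltnW.
rewrite /s !nth_cat /=; case: (ltnP j (size u)) => [-> //|uj].
by rewrite ltnNge !leqW // !subSn ?leqW.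
Qed.

Lemma nth_take_drop2 T (x0 : T) i s : (i.+1 < size s)%N ->
  take i s ++ nth x0 s i :: nth x0 s i.+1 :: drop i.+2 s = s.
Proof.
by move=> si; rewrite -!drop_nth // ?cat_take_drop // ltnW.
Qed.

(** [merge_vars] evaluates f on a word with equal letters at positions i and [i.+1], and [skip_vars]
    on what is left after deleting them. *)
Lemma ev_Sol f :
  (forall N (u v : seq {mpoly K[N]}) a,
    ev f (u ++ a :: a :: v) = ev f (u ++ v)) ->
  Sol_prop f.
Proof.
move=> fE m i; rewrite /merge_vars /skip_vars !comp_mpoly_subst.
set s := tval _; set t := tval _.
have szs : size s = m.+2 by rewrite size_tuple.
have szt : size t = m by rewrite size_tuple.
have -> : subst (f m.+2) s = ev f s by rewrite /ev szs.
have -> : subst (f m) t = ev f t by rewrite /ev szt.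
have nths j (jm : (j < m.+2)%N) :
    nth 0 s j = 'X_(if j == i.+1 :> nat then inord i else Ordinal jm).
  by rewrite -[j]/(val (Ordinal jm)) -tnth_nth tnth_mktuple.
have i1 : (i.+1 < m.+2)%N by rewrite ltnS.
have i0 : (i < m.+2)%N by rewrite ltnW.
have si : nth 0 s i = nth 0 s i.+1.
  rewrite !nths eqxx ltn_eqF //; congr 'X_[U_(_)%MM]; apply: val_inj.
  by rewrite /= inordK.
rewrite -[X in ev f X = _](@nth_take_drop2 _ 0 i) ?szs // -si fE.
congr (ev f _); apply: (@eq_from_nth _ 0) => [|j].
  by rewrite size_cat size_take size_drop szs i0 szt subSS subSS subnKC.
rewrite size_cat size_take size_drop szs i0 !subSS subnKC // => jm.
rewrite -[X in _ = nth _ _ X]/(val (Ordinal jm)) -tnth_nth tnth_mktuple.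
rewrite nth_cat size_take szs i0 /=; case: ltnP => ji.
  have jm' : (j < m.+2)%N by rewrite !leqW.
  rewrite nth_take // nths ltn_eqF; last by rewrite ltnW.
  by congr 'X_[U_(_)%MM]; apply: val_inj; rewrite /= inordK.
have jm' : (j.+2 < m.+2)%N by [].
rewrite nth_drop !addSn subnKC // (nths _ jm') gtn_eqF ?ltnS //.
by congr 'X_[U_(_)%MM]; apply: val_inj; rewrite /= inordK.
Qed.

End Evaluation.

(** * Iterated differences of functionals on words *)

Section Differences.
Variable A : comNzRingType.
Implicit Types (F G : seq A -> A) (u v ys : seq A).

(* The functional F on u (P_y1 - 1) ... (P_yk - 1) v; each 1 is written as the
   block (0, 0) so that all the words involved have the same length. *)
Fixpoint block_diff F u ys v : A :=
  if ys is y :: ys' then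
    block_diff F (u ++ [:: y; 0]) ys' v - block_diff F (u ++ [:: 0; 0]) ys' v
  else F (u ++ v).

Lemma block_diff_prefix F u u' ys v :
  (forall s, F (u ++ s) = F (u' ++ s)) ->
  block_diff F u ys v = block_diff F u' ys v.
Proof.
elim: ys u u' => [|y ys IHys] u u' uu' /=; first exact: uu'.
by congr (_ - _); apply: IHys => s; rewrite -!catA uu'.
Qed.

(** The common length of the words lets [ev f], whose component depends on the length, be replaced
    by [subst (f n)] for a single n. *)
Lemma eq_block_diff F G u ys v :
  (forall s, size s = (size u + (size ys).*2 + size v)%N -> F s = G s) ->
  block_diff F u ys v = block_diff G u ys v.
Proof.
elim: ys u => [|y ys IHys] u FG /=; first by rewrite FG // size_cat addn0.
by congr (_ - _); apply: IHys => s szs; apply: FG; rewrite szs size_cat /=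
  doubleS -!addnA.
Qed.

Lemma block_diff_sum T (r : seq T) (F : T -> seq A -> A) u ys v :
  block_diff (fun s => \sum_(t <- r) F t s) u ys v =
    \sum_(t <- r) block_diff (F t) u ys v.
Proof. by elim: ys u => //= y ys IHys u; rewrite !IHys sumrB. Qed.

(** The two blocks subtracted at step j, (y, 0) and (0, 0), differ only in the letter at position
    [size u + j.*2]. *)
Lemma block_diff_insensitive F u ys v j : (j < size ys)%N ->
  (forall s a b t, size s = (size u + j.*2)%N ->
    F (s ++ a :: t) = F (s ++ b :: t)) ->
  block_diff F u ys v = 0.
Proof.
elim: ys u j => //= y ys IHys u [|j] jys Fj.
  rewrite (@block_diff_prefix _ _ (u ++ [:: 0; 0])) ?subrr // => s.
  by rewrite -!catA /=; apply: Fj; rewrite addn0.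
by rewrite !(IHys _ j) ?subrr // => s a b t szs; apply: Fj;
  rewrite szs size_cat doubleS -addnA.
Qed.

End Differences.

(** * Injectivity: inverting the blocks P_x *)

Section Injectivity.
Variable K : comNzRingType.

Lemma block_diff_subst N n (p : {mpoly K[n]}) (u ys v : seq {mpoly K[N]}) :
  (msize p <= size ys)%N -> block_diff (subst p) u ys v = 0.
Proof.
move=> pys.
have -> : block_diff (subst p) u ys v = \sum_(m <- msupp p)
    block_diff (fun s => p@_m *: \prod_(i < n) nth 0 s i ^+ m i) u ys v.
  by rewrite -block_diff_sum; apply: eq_block_diff => s _; apply: substE.
apply: big1_seq => m /= /msize_mdeg_lt mp.
(* The positions occurring in m number at most [mdeg m], which is less than [size ys], so one of the
   positions [size u + j.*2] is missed. *)
pose S := [seq val i | i <- enum [pred i : 'I_n | 0 < m i]%N].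
have szS : (size S <= mdeg m)%N.
  rewrite size_map -cardE -sum1_card mdegE big_mkcond /=.
  by apply: leq_sum => i _; rewrite inE; case: (m i).
have [j jys jS] : exists2 j, (j < size ys)%N & (size u + j.*2)%N \notin S.
  apply: contrapT => noj; suff: (size ys <= size S)%N.
    by rewrite leqNgt (leq_ltn_trans szS (leq_trans mp pys)).
  have -> : size ys = size [seq (size u + j.*2)%N | j <- iota 0 (size ys)].
    by rewrite size_map size_iota.
  apply: uniq_leq_size => [|l /mapP[j jys ->]].
    rewrite map_inj_uniq ?iota_uniq // => i j /addnI /(congr1 half).
    by rewrite !doubleK.
  rewrite mem_iota /= in jys; apply: contrapT => /negP jS; case: noj.
  by exists j.
apply: (block_diff_insensitive _ jys) => s a b t szs; congr (_ *: _).
apply: eq_bigr => i _; rewrite !nth_cat; case: ltngtP => // [|si].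
  by rewrite -subn_gt0; case: (i - size s)%N.
suff -> : m i = 0%N by rewrite !expr0.
apply/eqP; rewrite -leqn0 leqNgt; apply: contra jS => mi.
by rewrite -szs -si; apply/mapP; exists i; rewrite // mem_enum.
Qed.

Definition interleave0 N (y : seq {mpoly K[N]}) :=
  flatten [seq [:: a; 0] | a <- y].

Lemma interleave0_rcons N (y : seq {mpoly K[N]}) a :
  interleave0 (rcons y a) = interleave0 y ++ [:: a; 0].
Proof. by rewrite /interleave0 map_rcons flatten_rcons. Qed.

Lemma Sol_ev_eq0 (f : stable_poly K) N : Sol_prop f ->
  (forall y : seq {mpoly K[N]}, ev f (interleave0 y) = 0) ->
  forall s : seq {mpoly K[N]}, ev f s = 0.
Proof.
move=> fS f0.
(* [Z v] says that f vanishes on v preceded by any product of blocks P_a. It is propagated to the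
   left, two letters at a time. *)
pose Z (v : seq {mpoly K[N]}) :=
  forall y : seq {mpoly K[N]}, ev f (interleave0 y ++ v) = 0.
have Z0 x v : Z v -> Z [:: 0, x & v].
  move=> Zv y; have [d fd] := stable_bounded f.
  pose D (u : seq {mpoly K[N]}) j (v : seq {mpoly K[N]}) :=
    block_diff (ev f) u (nseq j x) v.
  (* The block (0, 0) is itself P_0, so both terms of each difference again start with a product of
     blocks P_a. *)
  have Dy j : D (interleave0 y) j v = 0.
    elim: j y => [|j IHj] y; first exact: Zv.
    by rewrite /D /= -!interleave0_rcons -!/(D _ _ _) !IHj subrr.
  (* N_x (P_x - 1)^(j+1) = (P_x - 1)^j - N_x (P_x - 1)^j *)
  have DN j : D (interleave0 y ++ [:: 0; x]) j.+1 v =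
      - D (interleave0 y ++ [:: 0; x]) j v.
    rewrite -[LHS]/(D _ j v - D _ j v).
    rewrite [X in X - _](_ : _ = 0) ?sub0r.
      congr (- _); apply: block_diff_prefix => s.
      by rewrite -catA Sol_ev.
    rewrite -[RHS](Dy j); apply: block_diff_prefix => s.
    by rewrite -!catA /= -cat_rcons Sol_ev // cat_rcons Sol_ev.
  (* d bounds the [msize] of every component, in particular of the one for the common length n of
     the words. *)
  have Dd : D (interleave0 y ++ [:: 0; x]) d v = 0.
    set w := interleave0 y ++ _; pose n := (size w + d.*2 + size v)%N.
    rewrite -[RHS](block_diff_subst (p := f n) w (ys := nseq d x) v)
      ?size_nseq //.
    by apply: eq_block_diff => s szs; rewrite /ev szs size_nseq.
  have : D (interleave0 y ++ [:: 0; x]) 0 v = 0.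
    have D_eq0 j : D (interleave0 y ++ [:: 0; x]) j v = 0 ->
        D (interleave0 y ++ [:: 0; x]) 0 v = 0.
      by elim: j => // j IHj; rewrite DN => /eqP; rewrite oppr_eq0 => /eqP.
    exact: D_eq0 Dd.
  by rewrite /D /= -catA.
(* Inserting 0 0 turns x1 x2 into P_x1 N_x2. *)
have Zcons x1 x2 v : Z v -> Z [:: x1, x2 & v].
  move=> /(Z0 x2) Zv y; rewrite -[RHS](Zv (rcons y x1)) interleave0_rcons.
  by rewrite -catA /= -cat_rcons -[in RHS]cat_rcons Sol_ev.
have Zeven k s : size s = k.*2 -> Z s.
  elim: k s => [|k IHk] [|x1 [|x2 s]] //=; first by move=> _ y; rewrite cats0.
  by move=> [szs]; apply/Zcons/IHk.
(* A trailing 0, harmless by stability, makes an odd length even. *)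
move=> s; have [so|se] := boolP (odd (size s)).
  rewrite -ev_rcons0; apply: (Zeven (size s).+1./2 (rcons s 0) _ [::]).
  by rewrite size_rcons -[LHS]odd_double_half /= so.
apply: (Zeven (size s)./2 s _ [::]).
by rewrite -[LHS]odd_double_half (negPf se).
Qed.

End Injectivity.

(** * M_I on ordinary and alternating alphabets *)

Section AlternatingWords.
Variable A : comNzRingType.
Implicit Types (s u v : seq A) (I : seq nat).

(* Words and compositions are read from right to left: M_I(x_1, ..., x_n) is
   qsym_word [x_n; ...; x_1] (rev I). *)
Fixpoint qsym_word s I : A :=
  match s, I with
  | _, [::] => 1
  | [::], _ => 0
  | x :: s', i :: I' => qsym_word s' I + x ^+ i * qsym_word s' I'
  end.

(* M_I on x_1 - x_2 + x_3 - ..., read from right to left: the sign of the head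
   of the word is given by the parity of the number of letters after it. In the
   negative case the letter stays in place, which unrolls the inverse character
   recursively. *)
Fixpoint alt_word s : seq nat -> A :=
  if s isn't x :: s' then fun I => (nilp I)%:R else
  if odd (size s') then
    fix alt_neg I := if I is i :: I' then
      alt_word s' I - x ^+ i * alt_neg I' else 1
  else fun I => if I is i :: I' then
      alt_word s' I + x ^+ i * alt_word s' I' else 1.

Lemma alt_word_nil s : alt_word s [::] = 1.
Proof. by case: s => //= x s; case: ifP. Qed.

Lemma alt_word_cons x s i I : alt_word (x :: s) (i :: I) =
  if odd (size s) then alt_word s (i :: I) - x ^+ i * alt_word (x :: s) I
  else alt_word s (i :: I) + x ^+ i * alt_word s I.
Proof. by rewrite /=; case: ifP. Qed.

Arguments alt_word : simpl never.

(** The two copies of x carry opposite signs, and adding x is inverse to subtracting it; this is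
    checked by induction on I. Letters of u keep their signs, since the parity of what follows them
    is unchanged. *)
Lemma alt_word_cancel u v x I :
  alt_word (u ++ x :: x :: v) I = alt_word (u ++ v) I.
Proof.
elim: u I => [|y u IHu] I.
  rewrite !cat0s; elim: I => [|i I IHI]; first by rewrite !alt_word_nil.
  rewrite alt_word_cons alt_word_cons [odd (size (x :: v))]/= IHI.
  by case: (odd (size v)); rewrite ?subrK ?addrK.
elim: I => [|i I IHI]; first by rewrite !alt_word_nil.
rewrite !cat_cons !alt_word_cons in IHI *.
have -> : odd (size (u ++ [:: x, x & v])) = odd (size (u ++ v)).
  by rewrite !size_cat /= !addnS /= negbK.
by rewrite !IHu IHI.
Qed.

Lemma alt_word_cons0 s I : all (leq 1) I -> alt_word (0 :: s) I = alt_word s I.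
Proof.
case: I => [|i I] /=; first by rewrite !alt_word_nil.
move=> /andP[i0 _]; rewrite alt_word_cons.
by rewrite expr0n gtn_eqF // !mul0r subr0 addr0 if_same.
Qed.

(** Each x has an even number of letters after it and counts positively; each inserted 0 stands at a
    negative place and contributes nothing, as the parts are positive. *)
Lemma alt_word_interleave0 s I : all (leq 1) I ->
  alt_word (flatten [seq [:: 0; x] | x <- s]) I = qsym_word s I.
Proof.
elim: s I => [|x s IHs] [|i I] // IP; first by rewrite alt_word_nil.
have /= /andP[_ IP'] := IP.
have se (t : seq A) : odd (size (flatten [seq [:: 0; x] | x <- t])) = false.
  by elim: t => //= y t ->.
by rewrite /= alt_word_cons0 // alt_word_cons se !IHs.
Qed.

Lemma qsym_word_cons0 u v I : all (leq 1) I ->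
  qsym_word (u ++ 0 :: v) I = qsym_word (u ++ v) I.
Proof.
elim: u I => [|x u IHu] [|i I] //=; first by case: v.
  by move=> /andP[i0 _]; rewrite expr0n gtn_eqF // mul0r addr0.
by move=> /andP[i0 IP]; rewrite !IHu //= i0.
Qed.

End AlternatingWords.

(** * Naturality under ring morphisms *)

Section WordMorphisms.
Variables (A B : comNzRingType) (h : {rmorphism A -> B}).

Lemma rmorph_qsym_word s I : h (qsym_word s I) = qsym_word (map h s) I.
Proof.
elim: s I => [|x s IHs] [|i I] //=; rewrite ?rmorph0 ?rmorph1 //.
by rewrite rmorphD rmorphM rmorphXn !IHs.
Qed.

Lemma rmorph_alt_word s I : h (alt_word s I) = alt_word (map h s) I.
Proof.
elim: s I => [|x s IHs] I; first exact: rmorph_nat.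
elim: I => [|i I IHI]; first by rewrite !alt_word_nil rmorph1.
rewrite [map _ _]/= !alt_word_cons size_map; case: ifP => _.
  by rewrite rmorphB rmorphM rmorphXn IHI IHs.
by rewrite rmorphD rmorphM rmorphXn !IHs.
Qed.

End WordMorphisms.

(** * Preimages of the M_I in [Sol] *)

Section SolStable.
Variable K : comNzRingType.

Lemma alt_word_homog N (s : seq {mpoly K[N]}) I :
  {in s, forall x, x \is 1.-homog} -> alt_word s I \is (sumn I).-homog.
Proof.
elim: s I => [|x s IHs] I sh.
  by case: I => [|i I]; [exact: dhomog1 | exact: dhomog0].
have {}IHs J : alt_word s J \is (sumn J).-homog.
  by apply: IHs => y ys; apply: sh; rewrite inE ys orbT.
have xh i : x ^+ i \is i.-homog.
  rewrite -[X in X.-homog]mul1n; apply: dhomogMn; apply: sh.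
  by rewrite inE eqxx.
elim: I => [|i I IHI]; first by rewrite alt_word_nil dhomog1.
rewrite alt_word_cons; case: ifP => _.
  by apply: rpredB; [exact: IHs | apply: dhomogM].
by apply: rpredD; [exact: IHs | apply: dhomogM].
Qed.

Lemma vars_homog n : {in rev (vars K n), forall x, x \is 1.-homog}.
Proof.
by move=> x; rewrite mem_rev => /mapP[i _ ->]; rewrite dhomogX /= mdeg1.
Qed.

Lemma map_vars N (s : seq {mpoly K[N]}) :
  [seq x \mPo [tuple nth 0 s i | i < size s] | x <- vars K (size s)] = s.
Proof.
apply: (@eq_from_nth _ 0) => [|i]; rewrite size_map size_vars // => si.
rewrite (nth_map 0) ?size_vars // -[X in nth _ _ X]/(val (Ordinal si)) nth_vars.
by rewrite comp_mpolyXU -tnth_nth tnth_mktuple.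
Qed.

Lemma all_rev_composition (I : composition) : all (leq 1) (rev (val I)).
Proof. by rewrite all_rev; apply: valP. Qed.

Lemma sol_bounded (I : composition) :
  exists d, forall n, (msize (alt_word (rev (vars K n)) (rev (val I))) <= d)%N.
Proof.
exists (sumn (rev (val I))).+1 => n; rewrite msizeE.
apply/bigmax_leqP_seq => m mI _.
by rewrite ltnS (dhomog_mf (alt_word_homog _ (@vars_homog n)) mI).
Qed.

Lemma last_var0_vars n :
  [seq last_var0 x | x <- rev (vars K n.+1)] = 0 :: rev (vars K n).
Proof.
rewrite varsS rev_rcons /= -map_rev -map_comp.
rewrite (eq_map (_ : _ \o _ =1 id)) ?map_id; last by move=> p; apply: mwidenK.
congr (_ :: _).
by rewrite /last_var0 comp_mpolyXU -tnth_nth tnth_mktuple unlift_none.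
Qed.

Lemma sol_last0 (I : composition) n :
  last_var0 (alt_word (rev (vars K n.+1)) (rev (val I))) =
  alt_word (rev (vars K n)) (rev (val I)).
Proof.
rewrite /last_var0 rmorph_alt_word -/(last_var0 _) last_var0_vars.
exact/alt_word_cons0/all_rev_composition.
Qed.

Definition sol_stable (I : composition) : stable_poly K :=
  StablePoly (sol_bounded I) (sol_last0 I).

Lemma ev_sol_stable I N (s : seq {mpoly K[N]}) :
  ev (sol_stable I) s = alt_word (rev s) (rev (val I)).
Proof. by rewrite /ev /subst rmorph_alt_word map_rev map_vars. Qed.

Lemma sol_stable_Sol I : Sol_prop (sol_stable I).
Proof.
apply: ev_Sol => N u v a; rewrite !ev_sol_stable !rev_cat !rev_cons.
by rewrite -!cats1 -!catA alt_word_cancel.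
Qed.

Lemma monomial_qsym_word n I :
  monomial_qsym K n I = qsym_word (rev (vars K n)) (rev I).
Proof.
elim: n I => [|n IHn] I; case/lastP: I => [|I i].
- by rewrite monomial_qsym_nil; case: (rev _).
- by rewrite monomial_qsym0 rev_rcons /vars; case: (enum _) (size_enum_ord 0).
- by rewrite monomial_qsym_nil; case: (rev _).
rewrite monomial_qsym_rcons !IHn varsS !rev_rcons /= !rmorph_qsym_word.
by rewrite -map_rev mulrC.
Qed.

Lemma ev_QSym_M I N (s : seq {mpoly K[N]}) :
  ev (QSym_M K I) s = qsym_word (rev s) (rev (val I)).
Proof.
by rewrite /ev /subst /= monomial_qsym_word rmorph_qsym_word map_rev map_vars.
Qed.

Lemma ev_QSym_M_cons0 I N (u v : seq {mpoly K[N]}) :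
  ev (QSym_M K I) (u ++ 0 :: v) = ev (QSym_M K I) (u ++ v).
Proof.
rewrite !ev_QSym_M !rev_cat rev_cons -cats1 -catA.
exact/qsym_word_cons0/all_rev_composition.
Qed.

Lemma rev_interleave0 N (y : seq {mpoly K[N]}) :
  rev (interleave0 y) = flatten [seq [:: 0; x] | x <- rev y].
Proof.
elim/last_ind: y => // y x IHy.
by rewrite interleave0_rcons rev_cat rev_rcons /= -IHy.
Qed.

Lemma ev_sol_stable_interleave0 I N (y : seq {mpoly K[N]}) :
  ev (sol_stable I) (interleave0 y) = ev (QSym_M K I) y.
Proof.
rewrite ev_sol_stable ev_QSym_M rev_interleave0.
exact/alt_word_interleave0/all_rev_composition.
Qed.

End SolStable.

(** * Quasi-symmetry as invariance under deletion of zeros *)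

Section QuasiSymmetry.
Variable K : comNzRingType.

Lemma evB (f g : stable_poly K) N (s : seq {mpoly K[N]}) :
  ev (f - g) s = ev f s - ev g s.
Proof. exact: raddfB. Qed.

Lemma evZ c (f : stable_poly K) N (s : seq {mpoly K[N]}) :
  ev (c *: f) s = c *: ev f s.
Proof. exact: comp_mpolyZ. Qed.

Lemma ev_sum T (r : seq T) (F : T -> stable_poly K) N (s : seq {mpoly K[N]}) :
  ev (\sum_(t <- r) F t) s = \sum_(t <- r) ev (F t) s.
Proof. by rewrite /ev /subst stable_val_sum raddf_sum. Qed.

Lemma mcoeff_var0 n (p : {mpoly K[n]}) (i : 'I_n) (m : 'X_{1..n}) :
  m i = 0%N ->
  (p \mPo [tuple if j == i then 0 else 'X_j | j < n])@_m = p@_m.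
Proof.
move=> mi; rewrite comp_mpolyEX [in RHS](mpolyE p) !raddf_sum /=.
apply: eq_bigr => k _; rewrite !mcoeffZ mcoeffX comp_mpolyX; congr (_ * _).
have [ki|ki] := eqVneq (k i) 0%N.
  rewrite -mcoeffX (mpolyXE_id _ k); congr (_@_m).
  apply: eq_bigr => j _; rewrite tnth_mktuple.
  by case: eqP => // ->; rewrite ki !expr0.
rewrite (bigD1 i) //= tnth_mktuple eqxx expr0n (negPf ki) mul0r mcoeff0.
by case: (k =P m) ki => // ->; rewrite mi.
Qed.

Definition zero_deletion (f : stable_poly K) :=
  forall N (u v : seq {mpoly K[N]}),   ev f (u ++ 0 :: v) = ev f (u ++ v).

(** A coefficient at a monomial without x_i survives setting x_i = 0, and deleting that 0 leaves
    fewer variables. So only the monomials involving all variables matter. *)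
Lemma zero_deletion_eq0 f : zero_deletion f ->
  (forall n (m : 'X_{1..n}), (forall i : 'I_n, m i != 0%N) -> (f n)@_m = 0) ->
  f = 0.
Proof.
move=> f0 fm; apply: stable_polyP; elim=> [|n IHn]; rewrite stable_val0.
  by apply/mpolyP => m; rewrite mcoeff0 fm // => -[].
apply/mpolyP => m; rewrite mcoeff0.
have [/existsP[i /eqP mi]|] := boolP [exists i, m i == 0%N]; last first.
  by rewrite negb_exists => /forallP; apply: fm.
rewrite -(mcoeff_var0 _ mi) comp_mpoly_subst; set s := tval _.
have szs : size s = n.+1 by rewrite size_tuple.
have -> : subst (f n.+1) s = ev f s by rewrite /ev szs.
have -> : s = take i s ++ 0 :: drop i.+1 s.
  have si : nth 0 s i = 0 by rewrite -tnth_nth tnth_mktuple eqxx.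
  by rewrite -[X in _ ++ X :: _]si -drop_nth ?szs // cat_take_drop.
rewrite f0 -(@subst_stable _ _ _ n).
  by rewrite IHn stable_val0 /subst comp_mpoly0 mcoeff0.
by rewrite size_cat size_take size_drop szs ltn_ord subSS subnKC // -ltnS.
Qed.

Lemma mcoeff_cast (p : forall n, {mpoly K[n]}) k n
    (m : 'X_{1..k}) (m' : 'X_{1..n}) :
  k = n -> (forall (i : 'I_k) (j : 'I_n), i = j :> nat -> m i = m' j) ->
  (p k)@_m = (p n)@_m'.
Proof.
move=> kn; case: n / kn in m' * => mm'; congr (_@__).
by apply/mnmP => i; apply: mm'.
Qed.

Definition exponents (I : seq nat) : 'X_{1..size I} :=
  [multinom nth 0%N I i | i < size I].

Lemma mcoeff_mwidenMXn n (p : {mpoly K[n]}) j (m : 'X_{1..n.+1}) :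
  (mwiden p * 'X_ord_max ^+ j)@_m = if m ord_max == j
    then p@_[multinom m (widen_ord (leqnSn n) i) | i < n] else 0.
Proof.
case: eqP => [mj|/eqP mj].
  have {1}-> : m = (U_(ord_max) *+ j + mnmwiden
      [multinom m (widen_ord (leqnSn n) i) | i < n])%MM.
    apply/mnmP => i; rewrite mnmDE mulmnE mnm1E.
    case: (unliftP ord_max i) => [k ->|->].
      have -> : lift ord_max k = widen_ord (leqnSn n) k.
        by apply: val_inj; rewrite /= /bump leqNgt ltn_ord.
      rewrite mnmwiden_widen mnmE.
      by rewrite -val_eqE /= gtn_eqF.
    by rewrite eqxx mul1n mnmwiden_ordmax addn0.
  by rewrite mpolyXn mcoeffMX mwiden_mnmwiden.
rewrite (mwidenE (leqnn (msize p))) mulr_suml raddf_sum big1 // => k _.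
rewrite -scalerAl /= mcoeffZ mpolyXn -mpolyXD mcoeffX.
case: (_ =P m) mj => [<-|_ _]; last by rewrite mulr0.
by rewrite mnmDE mulmnE mnm1E eqxx mul1n mnmwiden_ordmax eqxx.
Qed.

(** A monomial of M_J that involves all n variables takes each of them once, in order, so its
    exponents spell J. *)
Lemma mcoeff_monomial_qsym (I J : seq nat) n (m : 'X_{1..n}) :
  all (leq 1) I -> all (leq 1) J -> size I = n ->
  (forall i : 'I_n, m i = nth 0%N I i) ->
  (monomial_qsym K n J)@_m = (J == I)%:R.
Proof.
elim: n I J m => [|n IHn] I J m.
  case: I => // _; case/lastP: J => [|J j] _ _ mI.
    rewrite monomial_qsym_nil mcoeff1.
    by case: eqP => // -[]; apply/mnmP => -[].
  rewrite monomial_qsym0 mcoeff0.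
  by case: eqP => // /(congr1 size); rewrite size_rcons.
case/lastP: I => // I i; rewrite all_rcons => /andP[i0 IP] JP.
rewrite size_rcons => -[szI] mI.
have mmax : m ord_max = i by rewrite mI nth_rcons szI ltnn eqxx.
case/lastP: J JP => [|J j].
  rewrite monomial_qsym_nil mcoeff1.
  case: eqP => [m0|_ _]; last by case: (I).
  by move: i0; rewrite -mmax m0 mnm0E.
rewrite all_rcons => /andP[j0 JP]; rewrite monomial_qsym_rcons mcoeffD.
(* The summand free of the last variable is written with exponent 0, which differs from i > 0, so it
   contributes nothing. *)
rewrite -[mwiden _]mulr1 -(expr0 'X_ord_max) !mcoeff_mwidenMXn mmax.
rewrite gtn_eqF // add0r eqseq_rcons [j == i]eq_sym.
case: (i == j); last by rewrite andbF.
rewrite andbT (IHn I) // => k; rewrite mnmE mI nth_rcons szI /=.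
by rewrite ltn_ord.
Qed.

Lemma bounded_compositions d :
  exists2 L : seq composition, uniq L &
    forall I, (sumn (val I) < d)%N -> I \in L.
Proof.
(* As parts are positive, a composition of sum below d has at most d parts, each below d. *)
pose s := [seq [seq val i | i : 'I_d <- val b] | b <- enum {: d.-bseq 'I_d}].
exists (undup (pmap insub s : seq composition)); first exact: undup_uniq.
case=> I IP /= Id; rewrite mem_undup mem_pmap; apply/mapP; exists I.
  have [J EJ] : exists J : seq 'I_d, I = map val J.
    elim: I Id {IP} => [|i I IHI] /=; first by exists [::].
    move=> Id; have [J ->] := IHI (leq_ltn_trans (leq_addl _ _) Id).
    by exists (Ordinal (leq_ltn_trans (leq_addr _ _) Id) :: J).
  have szJ : (size J <= d)%N.
    apply: leq_trans (ltnW Id).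
    rewrite -[size J](size_map val) -EJ; elim: I IP {Id EJ} => //= i I IHI.
    by move=> /andP[i0 /IHI]; apply: leq_add i0.
  by apply/mapP; exists (Bseq szJ); rewrite ?mem_enum.
by rewrite insubT.
Qed.

Lemma zero_deletion_QSym f : zero_deletion f -> f \in @QSym K.
Proof.
move=> f0; have [d fd] := stable_bounded f.
have [L Lu Ld] := bounded_compositions d.
(* The coefficient of M_I is read off in exactly as many variables as I has parts, where the
   monomial with exponents I involves them all. *)
pose c (I : composition) := (f (size (val I)))@_(exponents (val I)).
pose g := \sum_(I <- L) c I *: QSym_M K I.
suff /subr0_eq -> : f - g = 0.
  apply/asboolP; exists [seq (c J, J) | J <- L]; rewrite big_map.
  by apply: eq_bigr.
apply: zero_deletion_eq0 => [N u v|n m mP].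
  rewrite !evB f0; congr (_ - _); rewrite !ev_sum; apply: eq_bigr => I _.
  by rewrite !evZ ev_QSym_M_cons0.
pose s := [seq m i | i <- enum 'I_n].
have sP : all (fun i => 0 < i)%N s.
  by apply/allP => _ /mapP[i _ ->]; rewrite lt0n.
have szs : size s = n by rewrite size_map size_enum_ord.
have nths (i : 'I_n) : m i = nth 0%N s i.
  by rewrite (nth_map i) ?size_enum_ord // nth_ord_enum.
pose I : composition := exist _ s sP.
have cI : c I = (f n)@_m.
  by apply: (@mcoeff_cast (stable_val f)) => // i j ij; rewrite mnmE ij nths.
rewrite -[(f - g) n]/(f n - g n) mcoeffB /g stable_val_sum raddf_sum /=.
have E (J : composition) : (c J *: QSym_M K J n)@_m = c J * (J == I)%:R.
  rewrite mcoeffZ /= (@mcoeff_monomial_qsym s) //; exact: (valP J).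
rewrite (eq_bigr _ (fun J _ => E J)).
have [IL|IL] := boolP (I \in L).
  rewrite (bigD1_seq I) //= eqxx mulr1 big1 ?addr0 ?cI ?subrr // => J /negPf ->.
  by rewrite mulr0.
(* Outside L the sum of the parts is at least d, which exceeds the degree of [f n], so the
   coefficient of f vanishes too. *)
rewrite big1_seq => [|J /andP[_ JL]]; last first.
  by case: eqP JL IL => [->|_] => [->//|_ _]; rewrite mulr0.
rewrite subr0; apply/eqP; rewrite mcoeff_eq0; apply: msize_mdeg_ge.
apply: leq_trans (fd n) _; rewrite leqNgt; apply: contra IL => md.
apply: Ld; rewrite /= sumnE big_map big_enum /=.
by rewrite mdegE in md.
Qed.

End QuasiSymmetry.

(** * Restriction to the odd variables as an algebra isomorphism *)

Section OddVariables.
Variable K : comNzRingType.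
Implicit Type f : stable_poly K.

Lemma map_interleave0 k l (h : {rmorphism {mpoly K[k]} -> {mpoly K[l]}}) y :
  [seq h x | x <- interleave0 y] = interleave0 [seq h x | x <- y].
Proof. by elim: y => //= x y IHy; rewrite rmorph0 IHy. Qed.

Lemma odd_vars_bounded f :
  exists d, forall n, (msize (ev f (interleave0 (vars K n))) <= d)%N.
Proof.
have [d fd] := stable_bounded f; exists d => n.
apply: leq_trans (fd _); apply: msize_subst_le => x /flattenP[_ /mapP[y + ->]].
rewrite -mem_rev => /vars_homog yh; rewrite !inE => /orP[] /eqP -> //.
exact: dhomog0.
Qed.

Lemma odd_vars_last0 f n : last_var0 (ev f (interleave0 (vars K n.+1))) =
  ev f (interleave0 (vars K n)).
Proof.
rewrite /last_var0 ev_comp map_interleave0.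
have -> : [seq last_var0 x | x <- vars K n.+1] = rcons (vars K n) 0.
  by apply: (can_inj revK); rewrite -map_rev last_var0_vars rev_rcons.
by rewrite interleave0_rcons -cat_rcons cats1 !ev_rcons0.
Qed.

Definition odd_vars f : stable_poly K :=
  StablePoly (odd_vars_bounded f) (odd_vars_last0 f).

Lemma ev_odd_vars f N (s : seq {mpoly K[N]}) :
  ev (odd_vars f) s = ev f (interleave0 s).
Proof. by rewrite [LHS]ev_comp map_interleave0 map_vars. Qed.

(** A letter 0 becomes the block (0, 0), which can be deleted for f in [Sol]. *)
Lemma odd_vars_QSym f : f \in @Sol K -> odd_vars f \in @QSym K.
Proof.
move=> /asboolP fS; apply: zero_deletion_QSym => N u v.
rewrite !ev_odd_vars /interleave0 !map_cat !flatten_cat /=.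
exact: Sol_ev.
Qed.

Lemma odd_varsB f g : odd_vars (f - g) = odd_vars f - odd_vars g.
Proof. by apply: stable_polyP => n; apply: evB. Qed.

Lemma odd_varsZ c f : odd_vars (c *: f) = c *: odd_vars f.
Proof. by apply: stable_polyP => n; apply: evZ. Qed.

Lemma odd_vars1 : odd_vars 1 = 1.
Proof. by apply: stable_polyP => n; apply: comp_mpoly1. Qed.

Lemma odd_varsM f g : odd_vars (f * g) = odd_vars f * odd_vars g.
Proof. by apply: stable_polyP => n; apply: rmorphM. Qed.

Lemma odd_vars_sol_stable I : odd_vars (sol_stable K I) = QSym_M K I.
Proof.
by apply: stable_polyP => n; rewrite -[LHS]/(ev _ _) ev_sol_stable_interleave0
  ev_vars.
Qed.

Definition Sol_to_QSym (h : Sol_alg K) : QSym_alg K :=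
  exist _ (odd_vars (val h)) (odd_vars_QSym (valP h)).

Fact Sol_to_QSym_is_zmod_morphism : zmod_morphism Sol_to_QSym.
Proof. by move=> f g; apply: val_inj; rewrite /= odd_varsB. Qed.
Fact Sol_to_QSym_is_monoid_morphism : monoid_morphism Sol_to_QSym.
Proof.
split=> [|f g]; apply: val_inj; first exact: odd_vars1.
exact: odd_varsM.
Qed.
Fact Sol_to_QSym_is_scalable : scalable Sol_to_QSym.
Proof. by move=> c f; apply: val_inj; rewrite /= odd_varsZ. Qed.
HB.instance Definition _ := GRing.isZmodMorphism.Build
  (Sol_alg K) (QSym_alg K) Sol_to_QSym Sol_to_QSym_is_zmod_morphism.
HB.instance Definition _ := GRing.isMonoidMorphism.Build
  (Sol_alg K) (QSym_alg K) Sol_to_QSym Sol_to_QSym_is_monoid_morphism.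
HB.instance Definition _ := GRing.isScalable.Build
  K (Sol_alg K) (QSym_alg K) *:%R Sol_to_QSym Sol_to_QSym_is_scalable.

(** If [odd_vars f] is 0, then f vanishes on all products of blocks P_a, hence on all words, and
    [f n] is its value on the variables. *)
Lemma Sol_to_QSym_inj : injective Sol_to_QSym.
Proof.
apply: raddf_inj => f /(congr1 val) /= f0; apply: val_inj.
apply: stable_polyP => n; rewrite -ev_vars -[RHS]/((0 : stable_poly K) n).
rewrite stable_val0; apply: Sol_ev_eq0; first exact/asboolP/(valP f).
by move=> y; rewrite -ev_odd_vars f0 /ev stable_val0 /subst comp_mpoly0.
Qed.

Lemma Sol_to_QSym_surj (g : QSym_alg K) : exists h, Sol_to_QSym h = g.
Proof.
case: g => g gQ; have /asboolP[s gE] := gQ.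
have solS I : sol_stable K I \in @Sol K by apply/asboolP/sol_stable_Sol.
pose S I : Sol_alg K := exist (fun f => f \in @Sol K) (sol_stable K I) (solS I).
exists (\sum_(t <- s) t.1 *: S t.2).
apply: val_inj; rewrite [RHS]/= gE !raddf_sum /=; apply: eq_bigr => t _.
by rewrite odd_varsZ odd_vars_sol_stable.
Qed.

End OddVariables.

Theorem theorem1p1 (R : realType) :
  exists phi : {lrmorphism Sol_alg R[i] -> QSym_alg R[i]}, bijective phi.
Proof.
exists (@Sol_to_QSym R[i]).
pose h g := projT1 (cid (@Sol_to_QSym_surj R[i] g)).
have hK : cancel h (@Sol_to_QSym R[i]).
  by move=> g; rewrite /h; case: cid.
exists h => // f; apply: Sol_to_QSym_inj; exact: hK.
Qed.
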